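(* Let $n\ge0$ be an integer, and suppose that $|\gamma_{i,k}|<a_i^n$ and $q_{i,k}\in C^n[x_0,x_N]$ for $i=1,\ldots,N$, $k=1,\ldots,M$. For $j=0,1,\ldots,n$ let $G_{i,k,j}(x,y)=\gamma_{i,k,j}y+q_{i,k,j}(x)$ with $\gamma_{i,k,0}=\gamma_{i,k}$, $q_{i,k,0}=q_{i,k}$, and suppose that for $j=1,\ldots,n$ $$\gamma_{i,k,j}=\frac{\gamma_{i,k}}{a_i^j},\qquad q_{i,k,j}(x)=\frac{q_{i,k,j-1}^{(1)}(x)}{a_i},$$ and that the standing conditions listed in the context hold. Let $\sigma\in\Lambda$ and let $g_\sigma$ be the Super Fractal Interpolation Function (SFIF), for $\sigma$, corresponding to the SIFS $\big\{\{\mathbb{R}^2;\ (L_i(x),G_{i,k,j}(x,y)): i=1,\ldots,N\},\ k=1,\ldots,M\big\}$ with $j=0$. Then, for $j=1,2,\ldots,n$, the derivative $g_\sigma^{(j)}$ exists and is the SFIF, for the same $\sigma$, associated with the SIFS $\big\{\{\mathbb{R}^2;\ (L_i(x),G_{i,k,j}(x,y)): i=1,\ldots,N\},\ k=1,\ldots,M\big\}$ for the interpolation data $\{(x_i,y_{i,j}): i=0,1,\ldots,N\}$.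
   Context: Let $N\ge2$, $M>1$ be integers, $x_0<x_1<\cdots<x_N$ reals, $I=[x_0,x_N]$ (derivatives at the endpoints of $I$ are one-sided). For $i=1,\ldots,N$ let $L_i(x)=a_ix+b_i=\dfrac{(x_i-x_{i-1})x+(x_Nx_{i-1}-x_0x_i)}{x_N-x_0}$. General notions. A Super Iterated Function System (SIFS) associated with data $\{(x_i,z_i): i=0,\ldots,N\}$ is a pool of IFSs $\big\{\{\mathbb{R}^2;(L_i(x),F_{i,k}(x,y)): i=1,\ldots,N\},\ k=1,\ldots,M\big\}$ with $F_{i,k}(x,y)=c_{i,k}y+p_{i,k}(x)$, $|c_{i,k}|<1$, $c_{i,k}\neq c_{i,l}$ for $k\ne l$, $p_{i,k}$ continuous on $I$, satisfying the join-up conditions $F_{i,k}(x_0,z_0)=z_{i-1}$, $F_{i,k}(x_N,z_N)=z_i$. Write $\mathcal{H}$ for the nonempty compact subsets of $I\times\mathbb{R}$ with the Hausdorff metric and $W_k(A)=\bigcup_{i=1}^N\{(L_i(x),F_{i,k}(x,y)):(x,y)\in A\}$. Let $\Lambda$ be the set of sequences $\sigma=\sigma_1\sigma_2\ldots$ with $\sigma_m\in\{1,\ldots,M\}$. The attractor of the SIFS for $\sigma\in\Lambda$ is $\lim_{m\to\infty}W_{\sigma_m}\circ\cdots\circ W_{\sigma_1}(S_0)$ in the Hausdorff metric, where $S_0=\{(x_i,z_i): i=0,\ldots,N\}$. The Super Fractal Interpolation Function (SFIF) associated with (corresponding to) the SIFS for $\sigma$ is the continuous function $I\to\mathbb{R}$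 whose graph is this attractor. Standing conditions for the functions $G_{i,k,j}$. The parameters satisfy $\gamma_{i,k}\ne\gamma_{i,l}$ for $k\ne l$. For each $j=0,1,\ldots,n$ there are reals $y_{0,j},\ldots,y_{N,j}$ (not depending on $k$) such that for all $i=1,\ldots,N$ and $k=1,\ldots,M$ $$G_{i,k,j}(x_0,y_{0,j})=y_{i-1,j},\qquad G_{i,k,j}(x_N,y_{N,j})=y_{i,j};$$ in particular $G_{i-1,k,j}(x_N,y_{N,j})=G_{i,k,j}(x_0,y_{0,j})$ for $i=2,\ldots,N$, $y_{0,j}=\dfrac{q_{1,k}^{(j)}(x_0)}{a_1^j-\gamma_{1,k}}$ and $y_{N,j}=\dfrac{q_{N,k}^{(j)}(x_N)}{a_N^j-\gamma_{N,k}}$. For $j=0$ these are the original interpolation data $y_{i,0}=y_i$. Moreover, for $j=0,\ldots,n$ and $k\neq l$, $$\frac{\sum_{p=1}^N a_p\int_{x_0}^{x_N}q_{p,k,j}(t)\,dt}{1-\sum_{p=1}^N a_p\gamma_{p,k,j}}=\frac{\sum_{p=1}^N a_p\int_{x_0}^{x_N}q_{p,l,j}(t)\,dt}{1-\sum_{p=1}^N a_p\gamma_{p,l,j}}\neq1.$$ *)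

(* Defs.v *)
From HB Require Import structures.
From mathcomp Require Export all_boot all_order all_algebra.
From mathcomp Require Export all_classical all_reals all_analysis.
Export Order.TTheory GRing.Theory Num.Theory.
Export numFieldNormedType.Exports.

Set Implicit Arguments.
Unset Strict Implicit.
Unset Printing Implicit Defensive.

Local Open Scope classical_set_scope.
Local Open Scope ring_scope.

(* Differentiation relative to a set [D]: the difference quotient at [t] only
   sees points of [D], so on a compact interval the derivatives at the two
   endpoints are one-sided. *)

Definition diff_quot (R : realType) (f : R -> R) (t u : R) : R :=
  (f u - f t) / (u - t).

Definition derivable_in (R : realType) (D : set R) (f : R -> R) (t : R) : Prop :=
  cvg (diff_quot f t u @[u --> within D t^']).

Definition derive_in (R : realType) (D : set R) (f : R -> R) (t : R) : R :=
  lim (diff_quot f t u @[u --> within D t^']).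

Definition derive_in_n (R : realType) (D : set R) (n : nat) (f : R -> R) : R -> R :=
  iter n (derive_in D) f.

Definition derivable_in_n (R : realType) (D : set R) (n : nat) (f : R -> R) : Prop :=
  forall m, (m < n)%N -> forall t, D t -> derivable_in D (derive_in_n D m f) t.

Definition Cn_in (R : realType) (D : set R) (n : nat) (f : R -> R) : Prop :=
  derivable_in_n D n f /\ {within D, continuous (derive_in_n D n f)}.

(* The norm of [R * R] is the sup norm of the plane; the Euclidean norm gives the
   same convergent sequences. *)
Definition hausdorff_dist (R : realType) (A B : set (R * R)) : \bar R :=
  Order.max (ereal_sup [set ereal_inf [set `|a - b|%:E | b in B] | a in A])
            (ereal_sup [set ereal_inf [set `|a - b|%:E | a in A] | b in B]).

(* The nodes are [x 0 < ... < x N]; values of [x] beyond [N] are irrelevant.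
   The maps are indexed from 0: [i : 'I_N] is the 1-based index [i + 1], so that
   it is attached to the subinterval from [x i] to [x i.+1].  In the same way,
   [k : 'I_M] is the index [k + 1], and [s m : 'I_M] is the term of rank [m + 1]
   of the sequence. *)

Definition node_itv (R : realType) (N : nat) (x : nat -> R) : set R :=
  `[x 0%N, x N]%classic.

Definition slope (R : realType) (N : nat) (x : nat -> R) (i : nat) : R :=
  (x i.+1 - x i) / (x N - x 0%N).

Definition intercept (R : realType) (N : nat) (x : nat -> R) (i : nat) : R :=
  (x N * x i - x 0%N * x i.+1) / (x N - x 0%N).

Definition node_map (R : realType) (N : nat) (x : nat -> R) (i : nat) (t : R) : R :=
  slope N x i * t + intercept N x i.

Definition vmap (R : realType) (N M : nat) (c : 'I_N -> 'I_M -> R)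
    (p : 'I_N -> 'I_M -> R -> R) (i : 'I_N) (k : 'I_M) (t y : R) : R :=
  c i k * y + p i k t.

Definition join_up (R : realType) (N M : nat) (x z : nat -> R)
    (c : 'I_N -> 'I_M -> R) (p : 'I_N -> 'I_M -> R -> R) : Prop :=
  forall (i : 'I_N) (k : 'I_M),
    vmap c p i k (x 0%N) (z 0%N) = z i /\ vmap c p i k (x N) (z N) = z i.+1.

Definition is_SIFS (R : realType) (N M : nat) (x z : nat -> R)
    (c : 'I_N -> 'I_M -> R) (p : 'I_N -> 'I_M -> R -> R) : Prop :=
  [/\ forall i k, `|c i k| < 1,
      forall i k l, k != l -> c i k != c i l,
      forall i k, {within node_itv N x, continuous (p i k)} &
      join_up x z c p].

Definition SIFS_op (R : realType) (N M : nat) (x : nat -> R)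
    (c : 'I_N -> 'I_M -> R) (p : 'I_N -> 'I_M -> R -> R) (k : 'I_M)
    (A : set (R * R)) : set (R * R) :=
  \bigcup_(i in [set: 'I_N])
    [set (node_map N x i u.1, vmap c p i k u.1 u.2) | u in A].

Definition data_set (R : realType) (N : nat) (x z : nat -> R) : set (R * R) :=
  [set (x i, z i) | i in [set i : nat | (i <= N)%N]].

(* The last symbol read is applied outermost, so the limit in [is_attractor] need
   not exist for every sequence [s]; [is_SFIF] is a relation for this reason. *)
Fixpoint SIFS_iter (R : realType) (N M : nat) (x z : nat -> R)
    (c : 'I_N -> 'I_M -> R) (p : 'I_N -> 'I_M -> R -> R) (s : nat -> 'I_M)
    (m : nat) : set (R * R) :=
  if m is m'.+1 then SIFS_op x c p (s m') (SIFS_iter x z c p s m')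
  else data_set N x z.

Definition in_H (R : realType) (N : nat) (x : nat -> R) (A : set (R * R)) : Prop :=
  [/\ A !=set0, compact A & A `<=` node_itv N x `*` setT].

Definition is_attractor (R : realType) (N M : nat) (x z : nat -> R)
    (c : 'I_N -> 'I_M -> R) (p : 'I_N -> 'I_M -> R -> R) (s : nat -> 'I_M)
    (A : set (R * R)) : Prop :=
  in_H N x A /\
  hausdorff_dist (SIFS_iter x z c p s m) A @[m --> \oo] --> (0 : \bar R)%E.

Definition graph_on (R : realType) (D : set R) (f : R -> R) : set (R * R) :=
  [set (t, f t) | t in D].

Definition is_SFIF (R : realType) (N M : nat) (x z : nat -> R)
    (c : 'I_N -> 'I_M -> R) (p : 'I_N -> 'I_M -> R -> R) (s : nat -> 'I_M)
    (f : R -> R) : Prop :=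
  [/\ is_SIFS x z c p,
      {within node_itv N x, continuous f} &
      is_attractor x z c p s (graph_on (node_itv N x) f)].

Definition integral_ratio (R : realType) (N M : nat) (x : nat -> R)
    (c : 'I_N -> 'I_M -> R) (p : 'I_N -> 'I_M -> R -> R) (k : 'I_M) : R :=
  (\sum_(i < N) slope N x i *
      \int[lebesgue_measure]_(t in node_itv N x) p i k t) /
  (1 - \sum_(i < N) slope N x i * c i k).

(* Main.v *)
Require Import Defs.
From mathcomp Require Import ring lra zify.

(** The last symbol of a word is applied outermost, so the sets obtained from the
data set along a sequence of symbols converge only in special cases, and the
proof starts by finding out which. Suppose that they converge to the graph of
[g]. If a symbol [k] occurs infinitely often, continuity of the maps of index
[k] shows that they send the graph of [g] into itself, that is
  g (L_i t) = c_ik * g t + p_ik t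
for every piece [i] ([attractor_self_affine]): [g] is the fixed point of the
system of index [k]. The alphabet is finite, so that from some rank on only such
symbols occur ([eventually_recurrent]). Conversely, if a continuous [h] solves
the equation of every symbol from some rank on, then from that rank on each step
multiplies vertical distances to the graph of [h] by at most a fixed ratio
[r < 1], while the abscissae become dense; hence the sets converge to the graph
of [h] ([self_affine_attractor]).

It remains to differentiate the functional equation. Let [h] be continuous with
h (L_i t) = c_i * h t + p_i t, where [|c_i|] is less than the slope [a_i] of
[L_i], and [p_i] is continuously differentiable. A derivative of [h] would solve
  d (L_i t) = (c_i / a_i) * d t + p_i' t / a_i,
and since [|c_i / a_i| < 1] and the join-up conditions hold, this equation has a
continuous solution [d], the uniform limit of the iterates of a contraction
([self_affine_exists]). If [F] is an antiderivative of [d], then F (L_i t) and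
c_i * F t + p_i t have the same derivative, so that [h - F] satisfies the
homogeneous equation up to a constant on each piece. As the [a_i] add up to 1,
the [c_i] add up to less than 1, and this forces [h - F] to be constant
([self_affine_const_gap]). Therefore [h] is continuously differentiable
([self_affine_C1]), and once this is known for one recurrent symbol, its
derivative solves the differentiated equation of every recurrent symbol
([self_affine_deriv]).

The coefficients of order [j] satisfy [|gamma_i / a_i^j| < a_i^(n-j)], at most
[a_i] as long as [j < n]: the differentiation step can be repeated [n] times,
and at each order the converse direction above returns the attractor. *)

Set Implicit Arguments.
Unset Strict Implicit.
Unset Printing Implicit Defensive.

Local Open Scope classical_set_scope.
Local Open Scope ring_scope.

(** * Continuity and differentiation relative to a set *)

Section RelativeDerivative.
Variables (R : realType) (D : set R).
Implicit Types (f g : R -> R) (t l : R).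

Lemma within_continuous_epsP f : {within D, continuous f} <->
  forall t, D t -> forall e : R, 0 < e ->
    exists2 d : R, 0 < d & forall u, D u -> `|u - t| < d -> `|f u - f t| < e.
Proof.
rewrite subspace_continuousP; split=> h t Dt.
  move=> e e0; have /cvgrPdist_lt/(_ e e0) := h t Dt.
  rewrite near_withinE => /nbhs_ballP[d /= d0 hd].
  exists d => // u Du ud; rewrite distrC; apply: (hd u) => //=.
  by rewrite /ball /= distrC.
apply/cvgrPdist_lt => e e0; have [d d0 hd] := h t Dt e e0.
rewrite near_withinE; apply/nbhs_ballP; exists d => //= u ud Du.
by rewrite distrC; apply: hd => //; rewrite distrC.
Qed.

Lemma within_continuous_norm f : {within D, continuous f} ->
  {within D, continuous (fun t => `|f t|)}.
Proof. by move=> fc t; apply: continuous_comp; [exact: fc|exact: norm_continuous]. Qed.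

Lemma within_continuous_lin (a b : R) f g :
  {within D, continuous f} -> {within D, continuous g} ->
  {within D, continuous (fun t => a * f t + b * g t)}.
Proof.
rewrite !subspace_continuousP => fc gc t Dt.
by apply: cvgD; apply: cvgMr; [exact: fc|exact: gc].
Qed.

(** A relation rather than the value of [derive_in]: the differentiation rules then
establish existence and value of the limit together, on any set [D]. *)
Definition has_deriv f t l := diff_quot f t u @[u --> within D t^'] --> l.

Lemma has_deriv_epsP f t l : has_deriv f t l <->
  forall e : R, 0 < e -> exists2 d : R, 0 < d &
    forall u, D u -> `|u - t| < d -> `|f u - f t - l * (u - t)| <= e * `|u - t|.
Proof.
have E u : u != t -> f u - f t - l * (u - t) = - (l - diff_quot f t u) * (u - t).
  move=> ut; rewrite /diff_quot mulNr mulrBl divfK ?subr_eq0 //; ring.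
split=> h.
  move=> e e0; have /cvgrPdist_lt/(_ e e0) := h.
  rewrite near_withinE; rewrite near_withinE => /nbhs_ballP[d /= d0 hd].
  exists d => // u Du ud; have [->|ut] := eqVneq u t.
    by rewrite !subrr mulr0 subr0 normr0 mulr0.
  rewrite E // normrM normrN; apply: ler_wpM2r => //; apply: ltW.
  by apply: (hd u) => //=; rewrite /ball /= distrC.
apply/cvgrPdist_le => e e0; have [d d0 hd] := h e e0.
rewrite near_withinE; rewrite near_withinE; apply/nbhs_ballP.
exists d => //= u; rewrite /ball /= distrC => ud ut Du; have := hd u Du ud.
by rewrite E // normrM normrN ler_pM2r // normr_gt0 subr_eq0.
Qed.

Lemma has_deriv_derive_in f t : derivable_in D f t -> has_deriv f t (derive_in D f t).
Proof. by []. Qed.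

Lemma has_deriv_eq f g t l : D t -> (forall u, D u -> f u = g u) ->
  has_deriv f t l -> has_deriv g t l.
Proof.
move=> Dt fg /has_deriv_epsP h; apply/has_deriv_epsP => e /h[d d0 hd].
by exists d => // u Du ud; rewrite -!fg //; apply: hd.
Qed.

Lemma has_deriv_continuous f (f' : R -> R) :
  (forall t, D t -> has_deriv f t (f' t)) -> {within D, continuous f}.
Proof.
move=> h; apply/within_continuous_epsP => t Dt e e0.
have /has_deriv_epsP/(_ 1 ltr01)[d d0 hd] := h t Dt.
have K0 : 0 < 1 + `|f' t| by apply: ltr_pwDl.
exists (Num.min d (e / (1 + `|f' t|))).
  by rewrite lt_min d0 divr_gt0.
move=> u Du; rewrite lt_min => /andP[ud ue].
have -> : f u - f t = (f u - f t - f' t * (u - t)) + f' t * (u - t) by ring.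
apply: (le_lt_trans (ler_normD _ _)).
rewrite normrM; apply: (@le_lt_trans _ _ ((1 + `|f' t|) * `|u - t|)).
  by rewrite mulrDl lerD2r; apply: hd.
by rewrite mulrC -ltr_pdivlMr.
Qed.

Lemma has_deriv_lin f g t l k (a b : R) : has_deriv f t l -> has_deriv g t k ->
  has_deriv (fun u => a * f u + b * g u) t (a * l + b * k).
Proof.
move=> hf hg; rewrite /has_deriv.
have -> : diff_quot (fun u => a * f u + b * g u) t =
    (fun u => a * diff_quot f t u + b * diff_quot g t u).
  by apply/funext => u; rewrite /diff_quot !mulrA -mulrDl; congr (_ / _); ring.
by apply: cvgD; apply: cvgMr.
Qed.

Lemma has_deriv_comp_affine f t l (a b : R) :
  (forall u, D u -> D (a * u + b)) ->
  has_deriv f (a * t + b) l -> has_deriv (fun u => f (a * u + b)) t (a * l).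
Proof.
move=> aD /has_deriv_epsP h; apply/has_deriv_epsP => e e0.
have K0 : 0 < 1 + `|a| by apply: ltr_pwDl.
have [d d0 hd] := h (e / (1 + `|a|)) (divr_gt0 e0 K0).
exists (d / (1 + `|a|)) => [|u Du]; first by rewrite divr_gt0.
rewrite ltr_pdivlMr // => ud.
have E : a * u + b - (a * t + b) = a * (u - t) by ring.
have la : `|a| * `|u - t| <= `|u - t| * (1 + `|a|).
  by rewrite mulrC ler_wpM2l // lerDr.
have /hd := aD _ Du; rewrite E normrM => /(_ (le_lt_trans la ud)).
rewrite mulrA [l * a]mulrC => /le_trans; apply.
rewrite -mulrA ler_wpM2l ?(ltW e0) // mulrC ler_pdivrMr //.
Qed.

End RelativeDerivative.

Arguments within_continuous_lin {R D} a b {f g}.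
Arguments has_deriv_lin {R D f g t l k} a b.

Section ClosedInterval.
Variables (R : realType) (a b : R).
Hypothesis ab : a < b.
Local Notation I := (`[a, b]%classic : set R).
Implicit Types (f : R -> R) (t l k : R).

Lemma in_segmentE t : I t <-> a <= t <= b.
Proof. by rewrite /I /= in_itv. Qed.

(** No point of a nondegenerate interval is isolated in it, endpoints included;
this is what makes one-sided limits at the endpoints unique. *)
Lemma within_dnbhs_itv_proper t : I t -> ProperFilter (within I t^').
Proof.
move=> /in_segmentE/andP[at_ tb]; apply: Build_ProperFilter_ex => P.
rewrite /within /= => /nbhs_ballP[d /= d0 hd].
(* There is room to the right of [t] unless [t = b], and then to the left. *)
have [atl|bt] := ltP t b.
  have m0 : 0 < Num.min (d / 2) (b - t) by rewrite lt_min divr_gt0 //= subr_gt0.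
  have m1 : Num.min (d / 2) (b - t) <= d / 2 by rewrite ge_min lexx.
  have m2 : Num.min (d / 2) (b - t) <= b - t by rewrite ge_min lexx orbT.
  move: m0 m1 m2; set m := Num.min _ _ => m0 m1 m2.
  exists (t + m); apply: hd => /=.
  - rewrite /ball /= opprD addNKr normrN gtr0_norm //; lra.
  - by rewrite -subr_eq0 addrC addKr gt_eqF.
  - by apply/in_segmentE; lra.
have m0 : 0 < Num.min (d / 2) (t - a).
  by rewrite lt_min divr_gt0 //= subr_gt0 (lt_le_trans ab bt).
have m1 : Num.min (d / 2) (t - a) <= d / 2 by rewrite ge_min lexx.
have m2 : Num.min (d / 2) (t - a) <= t - a by rewrite ge_min lexx orbT.
move: m0 m1 m2; set m := Num.min _ _ => m0 m1 m2.
exists (t - m); apply: hd => /=.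
- rewrite /ball /= opprB addrC subrK gtr0_norm //; lra.
- by rewrite -subr_eq0 addrC addKr oppr_eq0 gt_eqF.
- by apply/in_segmentE; lra.
Qed.

Lemma has_deriv_unique f t l k : I t -> has_deriv I f t l -> has_deriv I f t k -> l = k.
Proof.
move=> It; have FF := within_dnbhs_itv_proper It.
by apply: cvg_unique; exact: Rhausdorff.
Qed.

Lemma derive_inE f t l : I t -> has_deriv I f t l -> derive_in I f t = l.
Proof.
move=> It; have FF := within_dnbhs_itv_proper It.
by move=> /cvg_lim; apply; exact: Rhausdorff.
Qed.

Lemma has_deriv_derivable f t l : has_deriv I f t l -> derivable_in I f t.
Proof. by move=> h; apply/cvg_ex; exists l. Qed.

Lemma is_derive_has_deriv f t l : is_derive t 1 f l -> has_deriv I f t l.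
Proof.
case=> df dl; apply/has_deriv_epsP => e e0.
have : h^-1 *: ((f \o shift t) (h *: 1) - f t) @[h --> 0^'] --> l.
  by rewrite -dl; exact: df.
move=> /cvgrPdist_lt/(_ e e0); rewrite near_withinE => /nbhs_ballP[d /= d0 hd].
exists d => // u _ ud; have [->|ut] := eqVneq u t.
  by rewrite !subrr mulr0 subr0 normr0 mulr0.
have ut0 : u - t != 0 by rewrite subr_eq0.
have := hd (u - t); rewrite /ball /= sub0r normrN => /(_ ud ut0).
rewrite /shift /= -![_ *: _]/(_ * _) mulr1 subrK => h.
have -> : f u - f t - l * (u - t) = - (l - (u - t)^-1 * (f u - f t)) * (u - t).
  by rewrite mulNr mulrBl mulrAC mulVf //; ring.
by rewrite normrM normrN ler_wpM2r // ltW.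
Qed.

Lemma has_deriv_is_derive f t l : a < t < b -> has_deriv I f t l -> is_derive t 1 f l.
Proof.
move=> /andP[at_ tb] /has_deriv_epsP h.
have H : h^-1 *: ((f \o shift t) (h *: 1) - f t) @[h --> 0^'] --> l.
  apply/cvgrPdist_le => e e0; have [d d0 hd] := h e e0.
  rewrite near_withinE; apply/nbhs_ballP.
  exists (Num.min d (Num.min (t - a) (b - t))) => /=.
    by rewrite !lt_min d0 !subr_gt0 at_ tb.
  move=> k; rewrite /ball /= sub0r normrN !lt_min => /and3P[kd ka kb] k0.
  rewrite -[k *: 1]/(k * 1) -[_ *: _]/(_ * _) mulr1.
  have kI : I (k + t).
    by apply/in_segmentE; move: ka kb; rewrite !ltr_norml; lra.
  have := hd _ kI; rewrite addrK => /(_ kd).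
  have -> : f (k + t) - f t - l * k = - (l - k^-1 * (f (k + t) - f t)) * k.
    by rewrite mulNr mulrBl mulrAC mulVf //; ring.
  by rewrite normrM normrN ler_pM2r // normr_gt0.
have dv : derivable f t 1 by apply/cvg_ex; exists l.
by apply: DeriveDef => //; apply: cvg_lim; [exact: Rhausdorff|exact: H].
Qed.

Lemma has_deriv0_cst f : (forall t, I t -> has_deriv I f t 0) ->
  forall t, I t -> f t = f a.
Proof.
move=> f0 t /in_segmentE/andP[at_ tb].
have fc : {within I, continuous f} by apply: (@has_deriv_continuous _ _ _ (fun=> 0)).
have fct : {within `[a, t], continuous f}.
  apply: continuous_subspaceW fc => u /=; rewrite /I /= !in_itv /= => /andP[-> ut].
  exact: le_trans tb.
have [|c _] := @MVT_segment R f (fun=> 0) a t at_ _ fct.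
  move=> u; rewrite in_itv /= => /andP[au ut].
  apply: has_deriv_is_derive; first by rewrite au (lt_le_trans ut).
  by apply: f0; apply/in_segmentE; rewrite ltW //= ltW // (lt_le_trans ut).
by rewrite mul0r => /eqP; rewrite subr_eq0 => /eqP.
Qed.

(** Precomposing with the projection of the line onto the interval extends [f] to
a continuous function on the line; its integral has two-sided derivatives, also
at the endpoints. *)
Lemma within_continuous_antiderivative f : {within I, continuous f} ->
  exists F, forall t, I t -> has_deriv I F t (f t).
Proof.
move=> fc.
pose clamp u := Num.max a (Num.min b u).
have clampI u : I (clamp u).
  by apply/in_segmentE; rewrite /clamp le_max lexx /= ge_max ge_min lexx (ltW ab).
have clampE u : I u -> clamp u = u.
  by move=> /in_segmentE/andP[au ub]; rewrite /clamp min_r // max_r.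
have clamp1 u v : `|clamp u - clamp v| <= `|u - v|.
  have := ler_norm (u - v); have := ler_norm (v - u); rewrite [`|v - u|]distrC.
  rewrite /clamp; case: (leP b u) => ?; case: (leP b v) => ?;
    case: (leP a) => ?; rewrite ?(max_r (ltW ab)); try case: (leP a) => ?;
    move=> ? ?; move: (ltW ab) => ?; rewrite ler_norml; lra.
pose h u := f (clamp u).
have hc : continuous h.
  move=> t; apply/cvgrPdist_lt => e e0.
  have /within_continuous_epsP/(_ _ (clampI t) e e0)[d d0 hd] := fc.
  apply/nbhs_ballP; exists d => //= u ud.
  rewrite distrC; apply: hd => //; apply: le_lt_trans (clamp1 _ _) _.
  by rewrite distrC.
(* The margins [a - 1] and [b + 1] make both endpoints interior. *)
exists (fun v => \int[lebesgue_measure]_(u in `[a - 1, v]) h u) => t It.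
apply: is_derive_has_deriv; move: (It) => /in_segmentE/andP[at_ tb].
have [||||dF F'] := @continuous_FTC1_closed R h (a - 1) t (b + 1).
- lra.
- apply: continuous_compact_integrable; first exact: segment_compact.
  exact: continuous_subspaceT.
- lra.
- exact: hc.
apply: DeriveDef; first exact: dF.
by rewrite -derive1E; move: F'; rewrite /h clampE.
Qed.

End ClosedInterval.

Lemma within_continuous_eq (R : realType) (D : set R) (f g : R -> R) :
  (forall t, D t -> f t = g t) -> {within D, continuous f} -> {within D, continuous g}.
Proof.
move=> fg /within_continuous_epsP h; apply/within_continuous_epsP => t Dt e e0.
by have [d d0 hd] := h t Dt e e0; exists d => // u Du ud; rewrite -!fg //; exact: hd.
Qed.

Lemma within_continuous_scale (R : realType) (D : set R) (f : R -> R) (b : R) :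
  {within D, continuous f} -> {within D, continuous (fun t => f t * b)}.
Proof.
move=> fc; apply: within_continuous_eq (within_continuous_lin b 0 fc fc) => t _.
by rewrite mul0r addr0 mulrC.
Qed.

Lemma has_deriv_scale (R : realType) (D : set R) (f : R -> R) (t l b : R) : D t ->
  has_deriv D f t l -> has_deriv D (fun u => f u * b) t (l * b).
Proof.
move=> Dt fd; have := has_deriv_lin b 0 fd fd.
rewrite mul0r addr0 mulrC; apply: has_deriv_eq => // u _.
by rewrite mul0r addr0 mulrC.
Qed.

Section CnIn.
Variables (R : realType) (D : set R) (n : nat) (f : R -> R).
Hypothesis fn : Cn_in D n f.

Lemma Cn_in_has_deriv j t : (j < n)%N -> D t ->
  has_deriv D (derive_in_n D j f) t (derive_in_n D j.+1 f t).
Proof. by move=> jn Dt; apply: has_deriv_derive_in; apply: fn.1. Qed.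

Lemma Cn_in_continuous j : (j <= n)%N -> {within D, continuous (derive_in_n D j f)}.
Proof.
rewrite leq_eqVlt => /orP[/eqP->|jn]; first exact: fn.2.
by apply: has_deriv_continuous => t; exact: Cn_in_has_deriv.
Qed.

End CnIn.

(** The Heine-Cantor theorem, from the near-covering form of compactness: around
each [t], half the radius of continuity for [e / 2] serves all nearby points. *)
Lemma segment_uniform_continuous (R : realType) (a b : R) (f : R -> R) :
  {within `[a, b], continuous f} -> forall e : R, 0 < e -> exists2 d : R, 0 < d &
    forall t u, `[a, b]%classic t -> `[a, b]%classic u ->
      `|u - t| < d -> `|f u - f t| < e.
Proof.
move=> /within_continuous_epsP fc e e0.
have /compact_near_coveringP cov := @segment_compact R a b.
have := cov R (0^'+) (fun d t => `[a, b]%classic t -> forall u, `[a, b]%classic u ->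
  `|u - t| < d -> `|f u - f t| < e) _.
have H : forall t, `[a, b]%classic t -> \forall t' \near t & d \near 0^'+,
    `[a, b]%classic t' -> forall u, `[a, b]%classic u ->
    `|u - t'| < d -> `|f u - f t'| < e.
  move=> t It; have e20 : 0 < e / 2 by lra.
  have [k k0 hk] := fc t It _ e20.
  have k20 : 0 < k / 2 by lra.
  exists (ball t (k / 2), [set d | d <= k / 2]).
    split; first exact: nbhsx_ballx.
    exact: nbhs_right_le.
  move=> [t' d] /= [tt' dk] It' u Iu ut'.
  have h1 : `|f u - f t| < e / 2.
    apply: hk => //; move: tt' ut'; rewrite /ball /= !ltr_norml; lra.
  have h2 : `|f t' - f t| < e / 2.
    apply: hk => //; move: tt'; rewrite /ball /= !ltr_norml; lra.
  by move: h1 h2; rewrite !ltr_norml; lra.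
move=> /(_ _ H) near_d.
have [d [d0 hd]] : exists d : R, 0 < d /\ `[a, b]%classic `<=` (fun t => `[a, b]%classic t ->
    forall u, `[a, b]%classic u -> `|u - t| < d -> `|f u - f t| < e).
  near (0 : R)^'+ => d; exists d; split.
    by near: d; exact: nbhs_right_gt.
  by near: d.
by exists d => // t u It Iu; exact: hd.
Unshelve. all: by end_near. Qed.

(** * Elementary bounds *)

Lemma finite_lt_bound (R : realType) (T : finType) (f : T -> R) (b : R) :
  0 < b -> (forall i, f i < b) -> exists r, [/\ 0 <= r, r < b & forall i, f i <= r].
Proof.
move=> b0 fb; exists (\big[Num.max/0]_i f i); split.
- exact: bigmax_ge_id.
- by apply/bigmax_ltP; split.
- by move=> i; apply: le_bigmax.
Qed.

Lemma geometric_small (R : realType) (r B e : R) : 0 <= r -> r < 1 -> 0 < e ->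
  exists m0, forall m, (m0 <= m)%N -> r ^+ m * B <= e.
Proof.
move=> r0 r1 e0.
have : geometric B r @ \oo --> 0 by apply: cvg_geometric; rewrite ger0_norm.
move=> /cvgrPdist_le/(_ e e0)[m0 _ hm]; exists m0 => m mm.
have := hm m mm; rewrite /= sub0r normrN mulrC; apply: le_trans; exact: ler_norm.
Qed.

Lemma div_exprS (F : fieldType) (b s : F) (j : nat) : b / s ^+ j.+1 = b / s ^+ j / s.
Proof. by rewrite exprSr invfM mulrA. Qed.

Lemma scale_lt_slope (R : realType) (s b : R) (j n : nat) :
  0 < s -> (j <= n)%N -> `|b| < s ^+ n -> `|b / s ^+ j| < s ^+ (n - j).
Proof.
move=> s0 jn bs; rewrite normrM normfV (gtr0_norm (exprn_gt0 j s0)).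
by rewrite ltr_pdivrMr ?exprn_gt0 // -exprD subnK.
Qed.

(** * The node maps *)

Section Nodes.
Variables (R : realType) (N : nat) (x : nat -> R).
Hypotheses (N2 : (2 <= N)%N) (x_lt : forall i, (i < N)%N -> x i < x i.+1).
Local Notation I := (node_itv N x).
Local Notation L := (node_map N x).
Local Notation a := (slope N x).
Implicit Types (i : nat) (s t u : R).

Lemma node_lt i j : (i < j <= N)%N -> x i < x j.
Proof.
elim: j => // j IH /andP[ij jN]; move: ij; rewrite ltnS leq_eqVlt => /orP[/eqP->|ij].
  exact: x_lt.
by apply: lt_trans (x_lt jN); apply: IH; rewrite ij (ltnW jN).
Qed.

Lemma node_le i j : (i <= j <= N)%N -> x i <= x j.
Proof.
move=> /andP[]; rewrite leq_eqVlt => /orP[/eqP->//|ij jN].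
by apply/ltW/node_lt; rewrite ij.
Qed.

Lemma nodes_lt : x 0%N < x N.
Proof. by apply: node_lt; rewrite leqnn andbT (leq_trans _ N2). Qed.

Lemma node_itvE t : I t <-> x 0%N <= t <= x N.
Proof. exact: in_segmentE. Qed.

Lemma node_itv_node i : (i <= N)%N -> I (x i).
Proof. by move=> iN; apply/node_itvE; rewrite !node_le // ?iN ?leqnn. Qed.

Lemma width_gt0 : 0 < x N - x 0%N.
Proof. by rewrite subr_gt0 nodes_lt. Qed.

Lemma slope_gt0 i : (i < N)%N -> 0 < a i.
Proof. by move=> iN; rewrite /slope divr_gt0 ?width_gt0 // subr_gt0 x_lt. Qed.

(** A piece is strictly shorter than the whole interval because there are at
least two of them. *)
Lemma slope_lt1 i : (i < N)%N -> a i < 1.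
Proof.
move=> iN; rewrite /slope ltr_pdivrMr ?width_gt0 // mul1r.
have h0 : x 0%N <= x i by apply: node_le; rewrite (ltnW iN).
have h1 : x i.+1 <= x N by apply: node_le; rewrite iN leqnn.
have [i0|i0] := posnP i.
  have h2 : x i.+1 < x N by apply: node_lt; rewrite i0 N2 leqnn.
  by lra.
have h2 : x 0%N < x i by apply: node_lt; rewrite i0 (ltnW iN).
by lra.
Qed.

Lemma sum_slope : \sum_(i < N) a i = 1.
Proof.
rewrite /slope -mulr_suml -(big_mkord xpredT (fun i => x i.+1 - x i)) telescope_sumr //.
by rewrite divff // gt_eqF // width_gt0.
Qed.

Lemma node_mapB i s t : L i s - L i t = a i * (s - t).
Proof. by rewrite /node_map; ring. Qed.

Lemma node_map_left i : L i (x 0%N) = x i.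
Proof. by rewrite /node_map /slope /intercept; field; rewrite gt_eqF // width_gt0. Qed.

Lemma node_map_right i : L i (x N) = x i.+1.
Proof. by rewrite /node_map /slope /intercept; field; rewrite gt_eqF // width_gt0. Qed.

Lemma node_map_piece i t : (i < N)%N -> I t -> x i <= L i t <= x i.+1.
Proof.
move=> iN /node_itvE/andP[t0 tN]; rewrite -{1}node_map_left -node_map_right.
have a0 := ltW (slope_gt0 iN).
by apply/andP; split; rewrite -subr_ge0 node_mapB mulr_ge0 // subr_ge0.
Qed.

Lemma node_map_itv i t : (i < N)%N -> I t -> I (L i t).
Proof.
move=> iN /(node_map_piece iN)/andP[h1 h2]; apply/node_itvE.
rewrite (le_trans _ h1) ?(le_trans h2) // node_le //.
  by rewrite iN leqnn.
by rewrite (ltnW iN).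
Qed.

Definition node_inv i t := x 0%N + (t - x i) / a i.

Lemma node_invK i t : (i < N)%N -> L i (node_inv i t) = t.
Proof.
move=> iN; have := node_mapB i (node_inv i t) (x 0%N).
have -> : a i * (node_inv i t - x 0%N) = t - x i.
  by rewrite /node_inv addrAC subrr add0r mulrC divfK // gt_eqF ?slope_gt0.
by rewrite node_map_left => /addIr.
Qed.

Lemma node_map_inj i s t : (i < N)%N -> L i s = L i t -> s = t.
Proof.
move=> iN /eqP; rewrite -subr_eq0 node_mapB mulf_eq0 gt_eqF ?slope_gt0 //=.
by rewrite subr_eq0 => /eqP.
Qed.

Lemma node_inv_itv i t : (i < N)%N -> x i <= t <= x i.+1 -> I (node_inv i t).
Proof.
move=> iN /andP[h1 h2]; have a0 := slope_gt0 iN; apply/node_itvE.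
have := node_mapB i (node_inv i t) (x 0%N); have := node_mapB i (x N) (node_inv i t).
rewrite node_invK // node_map_left node_map_right => e1 e2.
apply/andP; split; rewrite -subr_ge0 -(pmulr_rge0 _ a0).
  by rewrite -e2 subr_ge0.
by rewrite -e1 subr_ge0.
Qed.

Lemma piece_exists t : I t -> exists i : 'I_N, x i <= t <= x i.+1.
Proof.
move=> /node_itvE/andP[t0 tN].
have : forall m, (m < N)%N -> t <= x m.+1 -> exists i : 'I_N, x i <= t <= x i.+1.
  elim=> [|m IH] mN tm; first by exists (Ordinal mN); rewrite /= t0 tm.
  have [h|h] := leP t (x m.+1); first by apply: IH => //; apply: ltnW.
  by exists (Ordinal mN); rewrite /= tm ltW.
have NE : N = N.-1.+1 by rewrite prednK // (leq_trans _ N2).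
by move=> /(_ N.-1); rewrite -NE; apply.
Qed.

Lemma node_map_surj t : I t -> exists (i : 'I_N) (s : R), I s /\ t = L i s.
Proof.
move=> /piece_exists[i h]; exists i, (node_inv i t).
by split; [apply: node_inv_itv|rewrite node_invK].
Qed.

(** The pieces [L_i I] are finitely many closed intervals that cover [I], so
continuity can be tested on each of them, after transport by [L_i]. *)
Lemma within_continuous_paste (f : R -> R) :
  (forall i : 'I_N, {within I, continuous (f \o L i)}) -> {within I, continuous f}.
Proof.
move=> fc.
have piece i : (i < N)%N -> {within `[x i, x i.+1], continuous f}.
  move=> iN; apply/within_continuous_epsP => t; rewrite /= in_itv /= => ti e e0.
  have a0 := slope_gt0 iN.
  have /within_continuous_epsP/(_ _ (node_inv_itv iN ti) e e0)[d d0 hd] := fc (Ordinal iN).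
  exists (a i * d) => [|u]; first exact: mulr_gt0.
  rewrite /= in_itv /= => ui ut; have := hd _ (node_inv_itv iN ui).
  rewrite /= !node_invK //; apply.
  rewrite -(ltr_pM2l a0) -{1}(gtr0_norm a0) -normrM -node_mapB !node_invK //.
have : forall m, (m <= N)%N -> {within `[x 0%N, x m], continuous f}.
  elim=> [|m IH] mN.
    by rewrite set_itv1; apply: continuous_subspace1.
  have -> : `[x 0%N, x m.+1]%classic = `[x 0%N, x m]%classic `|` `[x m, x m.+1]%classic.
    rewrite eqEsubset; split=> t /=; rewrite !in_itv /=.
      by move=> /andP[-> ->]; have [h|/ltW h] := leP t (x m); [left|right; rewrite h].
    have h0 : x 0%N <= x m by apply: node_le; rewrite (ltnW mN).
    have h1 := ltW (x_lt mN).
    by move=> [] /andP[ta tb]; lra.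
  by apply: withinU_continuous; [exact: interval_closed..|exact/IH/ltnW|exact: piece].
exact.
Qed.

Lemma within_continuous_bounded (f : R -> R) : {within I, continuous f} ->
  exists C, forall t, I t -> `|f t| <= C.
Proof.
move=> fc.
have [c _ hc] := EVT_max (ltW nodes_lt) (within_continuous_norm fc).
by exists `|f c| => t It; apply: hc.
Qed.

End Nodes.

(** * Self-affine functions *)

Section SelfAffine.
Variables (R : realType) (N : nat) (x : nat -> R).
Hypotheses (N2 : (2 <= N)%N) (x_lt : forall i, (i < N)%N -> x i < x i.+1).
Local Notation I := (node_itv N x).
Local Notation L := (node_map N x).
Local Notation a := (slope N x).

(** Invariance of the graph of [f] under the system of coefficients [c] and [p],
as a functional equation. *)
Definition self_affine (c : 'I_N -> R) (p : 'I_N -> R -> R) (f : R -> R) :=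
  forall (i : 'I_N) t, I t -> f (L i t) = c i * f t + p i t.

(** The maximum of [|f - g|] is attained at some [L_i s], where it is [|c_i|]
times the value at [s]; since [|c_i| < 1] it vanishes. *)
Lemma self_affine_unique c p (f g : R -> R) : (forall i, `|c i| < 1) ->
  {within I, continuous f} -> {within I, continuous g} ->
  self_affine c p f -> self_affine c p g -> forall t, I t -> f t = g t.
Proof.
move=> c_lt1 fc gc fa ga.
have dc : {within I, continuous (fun t => `|f t - g t|)}.
  have dc0 : {within I, continuous (fun t => f t - g t)}.
    have := within_continuous_lin 1 (-1) fc gc.
    by under eq_fun do rewrite mul1r mulN1r.
  exact: within_continuous_norm dc0.
have [m mI hm] := EVT_max (ltW (nodes_lt N2 x_lt)) dc.
have [i [s [Is ms]]] := node_map_surj N2 x_lt mI.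
have E : `|f m - g m| = `|c i| * `|f s - g s|.
  by rewrite ms fa // ga // -normrM; congr `|_|; ring.
have H : `|f m - g m| <= `|c i| * `|f m - g m|.
  by rewrite {1}E ler_wpM2l // hm.
have Z : `|f m - g m| = 0.
  apply/le_anti; rewrite normr_ge0 andbT leNgt; apply/negP => P.
  by have := c_lt1 i; rewrite -(ltr_pM2r P) mul1r ltNge H.
move=> t It; have := hm _ It; rewrite Z normr_le0 subr_eq0 => /eqP; exact.
Qed.

Section FixedPoint.
Variables (c : 'I_N -> R) (p : 'I_N -> R -> R) (z : nat -> R).
Hypotheses (c_lt1 : forall i, `|c i| < 1)
  (p_cont : forall i, {within I, continuous (p i)})
  (c_join : forall i : 'I_N, c i * z 0%N + p i (x 0%N) = z i /\
                             c i * z N + p i (x N) = z i.+1).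

(** The Read-Bajraktarevic operator, whose admissible fixed points are
self-affine. A node shared by two pieces is assigned to an arbitrary one of them;
[pieces_agree] makes this choice immaterial on [admissible] functions. *)
Definition read_bajraktarevic (f : R -> R) (t : R) : R :=
  if [pick i : 'I_N | x i <= t <= x i.+1] is Some i
  then c i * f (node_inv N x i t) + p i (node_inv N x i t) else 0.
Local Notation T := read_bajraktarevic.

Definition admissible (f : R -> R) :=
  [/\ {within I, continuous f}, f (x 0%N) = z 0%N & f (x N) = z N].

(** Two pieces [i < j] meet only if [j = i + 1], at the image of the right end
under [L_i] and of the left end under [L_j]; both expressions then equal the
prescribed value at that node. *)
Lemma pieces_agree f (i j : 'I_N) s t : f (x 0%N) = z 0%N -> f (x N) = z N ->
  I s -> I t -> L i s = L j t -> c i * f s + p i s = c j * f t + p j t.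
Proof.
move=> f0 fN.
wlog ij : i j s t / (i <= j)%N.
  by move=> W; have [?|/ltnW ?] := leqP i j; [exact: W|move=> ? ? /esym e; symmetry; exact: W].
move=> Is It e; move: ij; rewrite leq_eqVlt => /orP[/eqP/ord_inj ij|ij].
  by move: e; rewrite ij => /(node_map_inj N2 x_lt (ltn_ord j)) ->.
have /andP[_ h1] := node_map_piece N2 x_lt (ltn_ord i) Is.
have /andP[h2 _] := node_map_piece N2 x_lt (ltn_ord j) It.
have jN := ltn_ord j.
have h3 : x i.+1 <= x j by apply: (node_le x_lt); rewrite ij ltnW.
have e1 : L i s = x i.+1 by apply/le_anti; rewrite h1 (le_trans h3) // e.
have e2 : L j t = x j by apply/le_anti; rewrite h2 andbT -e (le_trans h1).
have e3 : j = i.+1 :> nat.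
  apply/eqP; rewrite eqn_leq ij andbT leqNgt; apply/negP => ij2.
  have := @node_lt _ _ _ x_lt i.+1 j; rewrite ij2 (ltnW jN) => /(_ isT).
  by rewrite -e1 -e2 e ltxx.
have -> : s = x N.
  by apply: (node_map_inj N2 x_lt (ltn_ord i)); rewrite node_map_right.
have -> : t = x 0%N.
  by apply: (node_map_inj N2 x_lt (ltn_ord j)); rewrite node_map_left.
by rewrite fN f0 (c_join i).2 (c_join j).1 e3.
Qed.

Lemma read_bajraktarevicE f (i : 'I_N) t : admissible f -> I t ->
  T f (L i t) = c i * f t + p i t.
Proof.
move=> [_ f0 fN] It; rewrite /T; case: pickP => [j hj|/(_ i)]; last first.
  by rewrite node_map_piece.
apply: pieces_agree => //; first exact: node_inv_itv.
by rewrite node_invK.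
Qed.

Lemma read_bajraktarevic_admissible f : admissible f -> admissible (T f).
Proof.
move=> af; have [fc f0 fN] := af; split.
- apply: within_continuous_paste => // i.
  apply/within_continuous_epsP => t It e e0.
  have gc : {within I, continuous (fun u => c i * f u + p i u)}.
    have := within_continuous_lin (c i) 1 fc (@p_cont i).
    by under eq_fun do rewrite mul1r.
  have /within_continuous_epsP/(_ t It e e0)[d d0 hd] := gc.
  by exists d => // u Iu ut; rewrite /= !read_bajraktarevicE //; exact: hd.
- have N0 : (0 < N)%N by rewrite (leq_trans _ N2).
  rewrite -[x 0%N](node_map_left N2 x_lt 0%N) (@read_bajraktarevicE _ (Ordinal N0)) //.
    by rewrite f0 (c_join _).1.
  exact/(node_itv_node x_lt).
- have N0 : (N.-1 < N)%N by rewrite prednK // (leq_trans _ N2).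
  have NE : N = N.-1.+1 by rewrite prednK // (leq_trans _ N2).
  rewrite [in T f _]NE -(node_map_right N2 x_lt N.-1) (@read_bajraktarevicE _ (Ordinal N0)) //.
    by rewrite fN (c_join _).2 /= -NE.
  exact/(node_itv_node x_lt).
Qed.

(** Any admissible function could start the iteration. *)
Definition chord (t : R) : R := z 0%N + (z N - z 0%N) / (x N - x 0%N) * (t - x 0%N).

Lemma chord_admissible : admissible chord.
Proof.
split; rewrite /chord.
- apply: continuous_subspaceT => t; apply: cvgD; first exact: cvg_cst.
  by apply: cvgMr; apply: cvgB; [exact: cvg_id|exact: cvg_cst].
- by rewrite subrr mulr0 addr0.
- by rewrite divfK ?subrKC // gt_eqF // width_gt0.
Qed.

(** The operator contracts the uniform distance by [r = max |c_i| < 1], so its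
iterates from the chord form a uniformly Cauchy sequence of continuous functions
and their limit is a fixed point. *)
Lemma self_affine_exists : exists2 d, {within I, continuous d} & self_affine c p d.
Proof.
have [r [r0 r1 cr]] := finite_lt_bound ltr01 c_lt1.
pose f m := iter m T chord.
have fA m : admissible (f m).
  by elim: m => [|m IH]; [exact: chord_admissible|exact: read_bajraktarevic_admissible].
have [C hC] : exists C, forall t, I t -> `|f 1%N t - f 0%N t| <= C.
  apply: within_continuous_bounded => //.
  have [[f1c _ _] [f0c _ _]] := (fA 1%N, fA 0%N).
  have := within_continuous_lin 1 (-1) f1c f0c.
  by under eq_fun do rewrite mul1r mulN1r.
(* [B] is the sum of the geometric series with first term [C], the fixed point
   of [u |-> r * u + C]. *)
pose B := C / (1 - r).
have step m q e : (forall t, I t -> `|f m t - f q t| <= e) ->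
    forall t, I t -> `|f m.+1 t - f q.+1 t| <= r * e.
  move=> h t /(node_map_surj N2 x_lt)[i [s [Is ->]]].
  rewrite /f /= (read_bajraktarevicE i (fA m) Is) (read_bajraktarevicE i (fA q) Is).
  rewrite opprD addrACA subrr addr0 -mulrBr.
  by rewrite normrM ler_pM // h.
have from0 : forall q t, I t -> `|f q t - f 0%N t| <= B.
  elim=> [|n IH] t It.
    rewrite subrr normr0 divr_ge0 ?subr_ge0 ?(ltW r1) //.
    by apply: le_trans (hC t It).
  have -> : f n.+1 t - f 0%N t = (f n.+1 t - f 1%N t) + (f 1%N t - f 0%N t) by ring.
  apply: (le_trans (ler_normD _ _)).
  have -> : B = r * B + C.
    by rewrite /B; field; rewrite subr_eq0 gt_eqF.
  by apply: lerD; [exact: (step n 0%N)|exact: hC].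
have cauchy : forall m q t, I t -> `|f (q + m)%N t - f m t| <= r ^+ m * B.
  elim=> [|m IH] q t It; first by rewrite addn0 expr0 mul1r; exact: from0.
  by rewrite addnS exprS -mulrA; apply: step => // u Iu; exact: IH.
have small e : 0 < e -> exists m0, forall m q t, (m0 <= m)%N -> (m <= q)%N -> I t ->
    `|f q t - f m t| <= e.
  move=> e0; have [m0 hm0] := geometric_small B r0 r1 e0.
  exists m0 => m q t mm mq It; apply: le_trans (hm0 m mm).
  by rewrite -(subnK mq); exact: cauchy.
have fcvg t : I t -> cvg (f m t @[m --> \oo]).
  move=> It; apply: cauchy_cvg; apply: cauchy_exP => e e0.
  have [m0 hm0] := small (e / 2) (divr_gt0 e0 (ltr0n _ 2)).
  exists (f m0 t); exists m0 => // q /= mq.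
  rewrite /ball /= distrC; apply: le_lt_trans (hm0 m0 q t _ mq It) _ => //.
  lra.
pose d t := lim (f m t @[m --> \oo]).
have close e : 0 < e -> exists m0, forall m t, (m0 <= m)%N -> I t -> `|d t - f m t| <= e.
  move=> e0; have e20 : 0 < e / 2 by lra.
  have [m0 hm0] := small _ e20; exists m0 => m t mm It.
  have /cvgrPdist_le/(_ _ e20)[q0 _ hq] := fcvg t It.
  have := hq (maxn q0 m) (leq_maxl _ _); rewrite -/(d t) => h1.
  have h2 := hm0 m (maxn q0 m) t mm (leq_maxr _ _) It.
  have -> : d t - f m t = (d t - f (maxn q0 m) t) + (f (maxn q0 m) t - f m t) by ring.
  by apply: (le_trans (ler_normD _ _)); lra.
exists d.
  apply/within_continuous_epsP => t It e e0; have e40 : 0 < e / 4 by lra.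
  have [m hm] := close _ e40.
  have [/within_continuous_epsP/(_ t It _ e40)[k k0 hk] _ _] := fA m.
  exists k => // u Iu ut.
  have := hk u Iu ut; have := hm m t (leqnn _) It; have := hm m u (leqnn _) Iu.
  by rewrite !ler_norml !ltr_norml; lra.
move=> i t It; apply/eqP; rewrite -subr_eq0 -normr_le0.
apply/ler_addgt0Pl => e e0; rewrite addr0; have e20 : 0 < e / 2 by lra.
have [m hm] := close _ e20.
have LI := node_map_itv N2 x_lt (ltn_ord i) It.
have h1 := hm m.+1 (L i t) (leqnSn m) LI.
have h2 := hm m t (leqnn m) It.
have -> : d (L i t) - (c i * d t + p i t) =
    (d (L i t) - f m.+1 (L i t)) - c i * (d t - f m t).
  by rewrite [f m.+1 _](read_bajraktarevicE i (fA m) It); ring.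
apply: (le_trans (ler_normB _ _)); rewrite normrM.
have : `|c i| * `|d t - f m t| <= 1 * `|d t - f m t|.
  by apply: ler_wpM2r => //; apply: ltW.
lra.
Qed.

End FixedPoint.
End SelfAffine.

(** * Derivatives of self-affine functions *)

Section Derivative.
Variables (R : realType) (N : nat) (x : nat -> R).
Hypotheses (N2 : (2 <= N)%N) (x_lt : forall i, (i < N)%N -> x i < x i.+1).
Local Notation I := (node_itv N x).
Local Notation L := (node_map N x).
Local Notation a := (slope N x).
Variables (c : 'I_N -> R) (p p' : 'I_N -> R -> R).
Hypothesis p_deriv : forall i t, I t -> has_deriv I (p i) t (p' i t).

Lemma has_deriv_node_map (f f' : R -> R) (i : 'I_N) t :
  (forall u, I u -> has_deriv I f u (f' u)) -> I t ->
  has_deriv I (f \o L i) t (a i * f' (L i t)).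
Proof.
move=> fd It; have H u : I u -> I (a i * u + intercept N x i).
  exact: node_map_itv.
by apply: has_deriv_comp_affine => //; apply: fd; exact: H.
Qed.

(** Both sides of the functional equation are differentiated within [I]. A limit
within [I] at [L_i t] restricts to the piece [L_i I], so the chain rule for [L_i]
applies also when [L_i t] is a node, where it gives a one-sided derivative. *)
Lemma self_affine_deriv (f f' : R -> R) :
  (forall t, I t -> has_deriv I f t (f' t)) ->
  self_affine x c p f ->
  self_affine x (fun i => c i / a i) (fun i t => p' i t / a i) f'.
Proof.
move=> fd fa i t It; have a0 : a i != 0 by rewrite gt_eqF // slope_gt0.
have h1 := has_deriv_node_map (i := i) fd It.
have h2 := has_deriv_lin (c i) 1 (fd t It) (p_deriv (i:=i) It).
have E : a i * f' (L i t) = c i * f' t + 1 * p' i t.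
  apply: (has_deriv_unique (nodes_lt N2 x_lt) It h1).
  by apply: has_deriv_eq h2 => // u Iu; rewrite /= fa // mul1r.
by rewrite -[f' (L i t)](mulKf a0) E; field.
Qed.

(** The increments of [D] over the pieces are [c_i] times its increment [w] over
[I]. Summing them gives w = (c_1 + ... + c_N) * w with a sum less than 1, so [w]
and all increments vanish: [D] takes one value at the nodes. This determines
[e], and the constant function with that value solves the same equation, so
uniqueness applies. *)
Lemma self_affine_const_gap (D : R -> R) (e : 'I_N -> R) :
  (forall i, `|c i| < a i) -> {within I, continuous D} ->
  (forall (i : 'I_N) t, I t -> D (L i t) = c i * D t + e i) ->
  forall t, I t -> D t = D (x 0%N).
Proof.
move=> ca Dc Da.
have Il := node_itv_node x_lt (leq0n N); have Ir := node_itv_node x_lt (leqnn N).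
have jump (i : 'I_N) : D (x i.+1) - D (x i) = c i * (D (x N) - D (x 0%N)).
  have := Da i _ Il; have := Da i _ Ir.
  by rewrite node_map_left // node_map_right // => -> ->; ring.
have sum_lt1 : \sum_(i < N) c i < 1.
  rewrite -(sum_slope N2 x_lt); apply: ltr_sum.
    by apply/hasP; exists (Ordinal (ltnW N2)) => //; rewrite mem_index_enum.
  by move=> i _; apply: le_lt_trans (ca i); exact: ler_norm.
have w0 : D (x N) - D (x 0%N) = 0.
  have E : D (x N) - D (x 0%N) = (\sum_(i < N) c i) * (D (x N) - D (x 0%N)).
    rewrite mulr_suml -(eq_bigr _ (fun i _ => jump i)).
    by rewrite -(big_mkord xpredT (fun i => D (x i.+1) - D (x i))) telescope_sumr.
  apply/eqP; move: E => /eqP; rewrite -subr_eq0 -{1}[D _ - _]mul1r -mulrBl mulf_eq0.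
  by rewrite subr_eq0 gt_eqF.
have node i : (i <= N)%N -> D (x i) = D (x 0%N).
  elim: i => [//|i IH] iN; rewrite -(IH (ltnW iN)).
  have /= := jump (Ordinal iN).
  by rewrite w0 mulr0 => /eqP; rewrite subr_eq0 => /eqP.
apply: (@self_affine_unique _ _ _ N2 x_lt c (fun i _ => (1 - c i) * D (x 0%N))) => //.
- by move=> i; apply: lt_trans (ca i) (slope_lt1 N2 x_lt _).
- by apply: continuous_subspaceT => ?; exact: cvg_cst.
- move=> i t It; rewrite Da //.
  have := Da i _ Il; rewrite node_map_left // node ?(ltnW (ltn_ord i)) //.
  by move=> E; rewrite mulrBl mul1r {1}E; ring.
- by move=> i t It; ring.
Qed.

(** The antiderivative [F] of the solution [d] of the differentiated equation
satisfies the equation of [h] up to a constant on each piece, hence differs from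
[h] by a constant. The data [z'] serve to make [d] well defined and continuous at
the nodes. *)
Lemma self_affine_C1 (z' : nat -> R) (h : R -> R) :
  (forall i, `|c i| < a i) ->
  (forall i, {within I, continuous (p' i)}) ->
  (forall i : 'I_N, c i / a i * z' 0%N + p' i (x 0%N) / a i = z' i /\
                    c i / a i * z' N + p' i (x N) / a i = z' i.+1) ->
  {within I, continuous h} -> self_affine x c p h ->
  exists2 d, {within I, continuous d} & forall t, I t -> has_deriv I h t (d t).
Proof.
move=> ca p'c join hc ha.
have x0N := nodes_lt N2 x_lt.
have a0 (i : 'I_N) : a i != 0 by rewrite gt_eqF // slope_gt0.
have [||d dc da] := @self_affine_exists _ _ _ N2 x_lt (fun i => c i / a i)
    (fun i t => p' i t / a i) z' _ _ join.
- move=> i; have ai := slope_gt0 N2 x_lt (ltn_ord i).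
  by rewrite normrM normfV (gtr0_norm ai) ltr_pdivrMr // mul1r.
- move=> i; have := within_continuous_lin (a i)^-1 0 (@p'c i) (@p'c i).
  by under eq_fun do rewrite mul0r addr0 mulrC.
exists d => //.
have [F Fd] := within_continuous_antiderivative x0N dc.
have Fc : {within I, continuous F} by exact: has_deriv_continuous Fd.
have gap (i : 'I_N) t : I t -> F (L i t) - (c i * F t + p i t) =
    F (L i (x 0%N)) - (c i * F (x 0%N) + p i (x 0%N)).
  pose G u := F (L i u) - (c i * F u + p i u); move=> It.
  suff G0 u : I u -> has_deriv I G u 0 by exact: (has_deriv0_cst G0 It).
  move=> Iu.
  have h1 := has_deriv_node_map (i := i) Fd Iu.
  have h2 := has_deriv_lin (c i) 1 (Fd u Iu) (p_deriv (i:=i) Iu).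
  have := has_deriv_lin 1 (-1) h1 h2.
  have -> : 1 * (a i * d (L i u)) + -1 * (c i * d u + 1 * p' i u) = 0.
    by rewrite da //; field.
  by apply: has_deriv_eq => // v Iv; rewrite /G /=; ring.
have Dc : {within I, continuous (fun t => h t - F t)}.
  have := within_continuous_lin 1 (-1) hc Fc.
  by under eq_fun do rewrite mul1r mulN1r.
have cst t : I t -> h t - F t = h (x 0%N) - F (x 0%N).
  apply: (self_affine_const_gap (e := fun i =>
    - (F (L i (x 0%N)) - (c i * F (x 0%N) + p i (x 0%N)))) ca Dc) => i u Iu.
  by rewrite ha // -(gap i u Iu); ring.
move=> t It.
have h0 : has_deriv I (fun=> 1) t 0.
  apply/has_deriv_epsP => e e0; exists 1 => // u _ _.
  by rewrite subrr mul0r subr0 normr0 mulr_ge0 // ltW.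
have := has_deriv_lin 1 (h (x 0%N) - F (x 0%N)) (Fd t It) h0.
rewrite mulr0 addr0 mul1r; apply: has_deriv_eq => // u Iu.
by rewrite mul1r mulr1 -(cst u Iu); ring.
Qed.

End Derivative.

(** * Hausdorff distance *)

Section Hausdorff.
Variable R : realType.
Implicit Types (A B : set (R * R)) (S : nat -> set (R * R)).

Lemma hausdorff_dist_le A B (e : R) :
  (forall u, A u -> exists2 v, B v & `|u - v| <= e) ->
  (forall v, B v -> exists2 u, A u & `|u - v| <= e) ->
  (hausdorff_dist A B <= e%:E)%E.
Proof.
move=> hA hB; rewrite ge_max; apply/andP; split; apply: ge_ereal_sup => _ [u Hu <-].
  have [v Bv uv] := hA u Hu; apply: (@le_trans _ _ `|u - v|%:E); last by rewrite lee_fin.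
  by apply: ereal_inf_lbound; exists v.
have [v Av uv] := hB u Hu; apply: (@le_trans _ _ `|v - u|%:E); last by rewrite lee_fin.
by apply: ereal_inf_lbound; exists v.
Qed.

Lemma hausdorff_dist_lt A B (e : R) : (hausdorff_dist A B < e%:E)%E ->
  (forall u, A u -> exists2 v, B v & `|u - v| < e) /\
  (forall v, B v -> exists2 u, A u & `|u - v| < e).
Proof.
rewrite gt_max => /andP[hA hB]; split=> u Hu.
  have : (ereal_inf [set `|u - b|%:E | b in B] < e%:E)%E.
    by apply: le_lt_trans hA; apply: ereal_sup_ubound; exists u.
  by move=> /ereal_inf_lt[_ [v Bv <-]]; rewrite lte_fin => uv; exists v.
have : (ereal_inf [set `|a - u|%:E | a in A] < e%:E)%E.
  by apply: le_lt_trans hB; apply: ereal_sup_ubound; exists u.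
by move=> /ereal_inf_lt[_ [v Bv <-]]; rewrite lte_fin => uv; exists v.
Qed.

Lemma hausdorff_dist_ge0 A B : A !=set0 -> (0 <= hausdorff_dist A B)%E.
Proof.
move=> [u Au]; rewrite le_max; apply/orP; left.
apply: (@le_trans _ _ (ereal_inf [set `|u - b|%:E | b in B])).
  by apply: le_ereal_inf_tmp => _ [v _ <-]; rewrite lee_fin.
by apply: ereal_sup_ubound; exists u.
Qed.

Lemma hausdorff_cvg0_lt S A : hausdorff_dist (S m) A @[m --> \oo] --> (0 : \bar R)%E ->
  forall e : R, 0 < e -> exists m0, forall m, (m0 <= m)%N ->
    (forall u, S m u -> exists2 v, A v & `|u - v| < e) /\
    (forall v, A v -> exists2 u, S m u & `|u - v| < e).
Proof.
move=> /fine_cvgP[Hfin /cvgrPdist_lt Hlt] e e0.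
have [m0 _ hm0] := filterI Hfin (Hlt e e0).
exists m0 => m mm; have [h1 h2] := hm0 m mm.
apply: hausdorff_dist_lt; rewrite -(fineK h1) lte_fin.
by apply: le_lt_trans h2; rewrite /= sub0r normrN ler_norm.
Qed.

Lemma hausdorff_cvg0_le S A : (forall m, S m !=set0) ->
  (forall e : R, 0 < e -> exists m0, forall m, (m0 <= m)%N ->
    (forall u, S m u -> exists2 v, A v & `|u - v| <= e) /\
    (forall v, A v -> exists2 u, S m u & `|u - v| <= e)) ->
  hausdorff_dist (S m) A @[m --> \oo] --> (0 : \bar R)%E.
Proof.
move=> S0 h.
have bnd e : 0 < e -> \forall m \near \oo, (0 <= hausdorff_dist (S m) A <= e%:E)%E.
  move=> e0; have [m0 hm] := h e e0; exists m0 => // m mm.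
  by have [hA hB] := hm m mm; rewrite hausdorff_dist_ge0 //= hausdorff_dist_le.
have fin_bnd (r : R) (d : \bar R) : (0 <= d <= r%:E)%E -> d \is a fin_num.
  by move=> /andP[h0 h1]; rewrite ge0_fin_numE // (le_lt_trans h1) ?ltry.
apply/fine_cvgP; split.
  by apply: filterS (bnd 1 ltr01) => m; exact: fin_bnd.
apply/cvgrPdist_le => e e0; apply: filterS (bnd e e0) => m hm.
have /andP[h0 h1] := hm; rewrite /= sub0r normrN ger0_norm ?fine_ge0 //.
by rewrite -lee_fin fineK //; exact: fin_bnd hm.
Qed.

End Hausdorff.

(** * Orbits of the data set under a sequence of symbols *)

Definition recurrent (M : nat) (s : nat -> 'I_M) (k : 'I_M) :=
  forall m0, exists2 m, (m0 <= m)%N & s m = k.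

(** Each of the finitely many symbols that are not recurrent is absent from some
rank on. *)
Lemma eventually_recurrent M (s : nat -> 'I_M) :
  exists m0, forall m, (m0 <= m)%N -> recurrent s (s m).
Proof.
have : forall k, exists mk, recurrent s k \/ forall m, (mk <= m)%N -> s m <> k.
  move=> k; have [rk|/existsNP[m0 h]] := pselect (recurrent s k); first by exists 0%N; left.
  by exists m0; right=> m mm e; apply: h; exists m.
move=> /choice[f hf]; exists (\max_k f k)%N => m mm.
have [//|h] := hf (s m); exfalso; apply: (h m) => //.
by apply: leq_trans mm; apply: leq_bigmax.
Qed.

Lemma prod_dist_leE (R : realType) (u v : R * R) (e : R) :
  (`|u - v| <= e) = (`|u.1 - v.1| <= e) && (`|u.2 - v.2| <= e).
Proof. by rewrite prod_normE ge_max. Qed.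

Section Orbit.
Variables (R : realType) (N M : nat) (x z : nat -> R).
Hypotheses (N2 : (2 <= N)%N) (x_lt : forall i, (i < N)%N -> x i < x i.+1).
Variables (c : 'I_N -> 'I_M -> R) (p : 'I_N -> 'I_M -> R -> R) (s : nat -> 'I_M).
Local Notation I := (node_itv N x).
Local Notation L := (node_map N x).
Local Notation a := (slope N x).
Local Notation S := (SIFS_iter x z c p s).

Lemma SIFS_iter_nonempty m : S m !=set0.
Proof.
elim: m => [|m [u Su]]; first by exists (x 0%N, z 0%N); exists 0%N.
exists (L 0 u.1, vmap c p (Ordinal (ltnW N2)) (s m) u.1 u.2).
by exists (Ordinal (ltnW N2)) => //; exists u.
Qed.

Lemma SIFS_iter_itv m u : S m u -> I u.1.
Proof.
elim: m u => [|m IH] u; first by case=> i /= iN <-; exact: (node_itv_node x_lt).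
by case=> i _ [v Sv <-]; apply: (node_map_itv N2 x_lt (ltn_ord i)); exact: IH.
Qed.

Lemma SIFS_iter_finite m : finite_set (S m).
Proof.
elim: m => [|m IH] /=.
  apply: finite_image; apply: (sub_finite_set _ (finite_II N.+1)) => i /=.
  by rewrite ltnS.
by apply: bigcup_finite => // i _; exact: finite_image.
Qed.

(** The abscissae of the orbit do not depend on the symbols: at every step the
distance from a point of [I] to the nearest abscissa is multiplied by at most
the largest slope. *)
Lemma SIFS_iter_dense : exists r B, [/\ 0 <= r, r < 1 &
  forall m t, I t -> exists2 u, S m u & `|u.1 - t| <= r ^+ m * B].
Proof.
have [r [r0 r1 ar]] := finite_lt_bound ltr01 (fun i : 'I_N => slope_lt1 N2 x_lt (ltn_ord i)).
exists r, (x N - x 0%N); split=> //; elim=> [|m IH] t It.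
  exists (x 0%N, z 0%N); first by exists 0%N.
  rewrite expr0 mul1r /= distrC ger0_norm; last by move/node_itvE: It => /andP[]; rewrite subr_ge0.
  by rewrite lerD2r; move/node_itvE: It => /andP[].
have [i [t' [It' ->]]] := node_map_surj N2 x_lt It.
have [u Su ut] := IH t' It'.
exists (L i u.1, vmap c p i (s m) u.1 u.2); first by exists i => //; exists u.
have ai := slope_gt0 N2 x_lt (ltn_ord i).
rewrite /= node_mapB normrM (gtr0_norm ai) exprS -mulrA.
by apply: ler_pM => //; exact: ltW.
Qed.

(** Once all symbols fix [h], each step multiplies the vertical distance to the
graph of [h] by some [c_ik]. The set reached at rank [m0] is finite, hence at a
bounded distance from the graph. *)
Lemma SIFS_iter_close (h : R -> R) m0 : (forall i k, `|c i k| < 1) ->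
  (forall m, (m0 <= m)%N -> self_affine x (c^~ (s m)) (p^~ (s m)) h) ->
  exists r B, [/\ 0 <= r, r < 1 & forall m u, S (m + m0)%N u ->
    `|u.2 - h u.1| <= r ^+ m * B].
Proof.
move=> c1 ha.
have [||r [r0 r1 cr]] := @finite_lt_bound R _ (fun ik : 'I_N * 'I_M => `|c ik.1 ik.2|) 1.
- exact: ltr01.
- by move=> ik; exact: c1.
have [B hB] : exists B, forall u, S m0 u -> `|u.2 - h u.1| <= B.
  have /finite_compact/compact_bounded/(pinfty_ex_gt (real0 R))[B _ hB] :=
    finite_image (fun u : R * R => u.2 - h u.1) (SIFS_iter_finite m0).
  by exists B => u Su; apply: hB; exists u.
exists r, B; split=> //; elim=> [|m IH] u; first by rewrite expr0 mul1r; exact: hB.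
rewrite addSn => -[i _ [v Sv <-]] /=.
rewrite (ha _ (leq_addl m m0) i _ (SIFS_iter_itv Sv)).
rewrite /vmap opprD addrACA subrr addr0 -mulrBr normrM exprS -mulrA.
by apply: ler_pM => //; [exact: (cr (i, _))|exact: IH].
Qed.

Lemma compact_graph (h : R -> R) : {within I, continuous h} -> compact (graph_on I h).
Proof.
move=> hc; apply: (@continuous_compact _ _ (fun t => (t, h t)) I _ (@segment_compact _ _ _)).
move/subspace_continuousP: hc => hc; apply/subspace_continuousP => t It.
exact: (cvg_pair (cvg_within (F := nbhs t) I) (hc t It)).
Qed.

(** Points of the orbit approach the graph vertically; conversely a point of the
graph has an orbit point with close abscissa, and uniform continuity of [h]
controls the ordinate. *)
Lemma self_affine_attractor (h : R -> R) m0 : (forall i k, `|c i k| < 1) ->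
  {within I, continuous h} ->
  (forall m, (m0 <= m)%N -> self_affine x (c^~ (s m)) (p^~ (s m)) h) ->
  is_attractor x z c p s (graph_on I h).
Proof.
move=> c1 hc ha; split; first split.
- exists (x 0%N, h (x 0%N)); exists (x 0%N) => //; exact: (node_itv_node x_lt).
- exact: compact_graph.
- by move=> _ [t It <-]; split.
apply: hausdorff_cvg0_le; first exact: SIFS_iter_nonempty.
move=> e e0; have e20 : 0 < e / 2 by lra.
have [d d0 hd] := segment_uniform_continuous hc e20.
have d20 : 0 < d / 2 by lra.
have [r [B [r0 r1 dense]]] := SIFS_iter_dense.
have [r' [B' [r0' r1' close]]] := SIFS_iter_close c1 ha.
have ed0 : 0 < Num.min e (d / 2) by rewrite lt_min e0.
have [m1 hm1] := geometric_small B r0 r1 ed0.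
have [m2 hm2] := geometric_small B' r0' r1' e20.
exists (m1 + m2 + m0)%N => m mm.
have close_m u : S m u -> `|u.2 - h u.1| <= e / 2.
  have mE : m = ((m - m0) + m0)%N by lia.
  rewrite mE => /close/le_trans; apply; apply: hm2; lia.
split=> [u Su|_ [t It <-]].
  exists (u.1, h u.1); first by exists u.1 => //; exact: SIFS_iter_itv Su.
  rewrite prod_dist_leE /= subrr normr0 ltW //=.
  by apply: le_trans (close_m u Su) _; lra.
have [u Su ut] := dense m t It; exists u => //.
have := hm1 m; rewrite le_min => /(_ _)/andP[|b1 b2]; first by lia.
rewrite prod_dist_leE /= (le_trans ut b1) /=.
have Iu := SIFS_iter_itv Su.
have h1 : `|h u.1 - h t| < e / 2.
  by apply: hd => //; apply: le_lt_trans ut _; apply: le_lt_trans b2 _; lra.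
have := close_m u Su; move: h1; rewrite !ler_norml !ltr_norml; lra.
Qed.

(** A point of the graph is approached by orbit points [u], also at ranks followed
by the symbol [k]. The image of [u] under the map of indices [i] and [k] is again
in the orbit, hence close to a point of the graph, and in the limit the image of
the given point is on the graph. *)
Lemma attractor_self_affine (f : R -> R) k :
  (forall i, `|c i k| < 1) -> (forall i, {within I, continuous (p i k)}) ->
  {within I, continuous f} ->
  is_attractor x z c p s (graph_on I f) -> recurrent s k ->
  self_affine x (c^~ k) (p^~ k) f.
Proof.
move=> c1 pc fc [_ /hausdorff_cvg0_lt conv] rk i t It.
apply/eqP; rewrite -subr_eq0 -normr_le0.
apply/ler_addgt0Pl => e e0; rewrite addr0.
have e40 : 0 < e / 4 by lra.
have ai := slope_gt0 N2 x_lt (ltn_ord i).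
have a1 := slope_lt1 N2 x_lt (ltn_ord i).
have /within_continuous_epsP/(_ _ (node_map_itv N2 x_lt (ltn_ord i) It) _ e40)[d d0 hd] := fc.
have /within_continuous_epsP/(_ _ It _ e40)[d' d0' hd'] := @pc i.
pose n := Num.min (e / 4) (Num.min (d / 2) d').
have n0 : 0 < n by rewrite !lt_min e40 d0' andbT /=; lra.
have [ne nd nd'] : [/\ n <= e / 4, n <= d / 2 & n <= d'].
  by split; rewrite /n !ge_min lexx ?orbT.
have [m0 hm] := conv n n0; have [m mm sm] := rk m0.
have [_ /(_ (t, f t))[|u Su]] := hm m mm; first by exists t.
have Iu := SIFS_iter_itv Su.
rewrite prod_normE gt_max /= => /andP[u1 u2].
have [/(_ (L i u.1, vmap c p i k u.1 u.2))S_step _] := hm m.+1 (leqW mm).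
have [|_ [w Iw <-]] := S_step; first by rewrite -sm; exists i => //; exists u.
rewrite prod_normE gt_max /= => /andP[w1 w2].
have h1 : `|f w - f (L i t)| < e / 4.
  apply: hd => //.
  have h : `|L i u.1 - L i t| < n.
    rewrite node_mapB normrM (gtr0_norm ai); apply: le_lt_trans u1.
    by rewrite ler_piMl // ltW.
  move: h w1; rewrite !ltr_norml; lra.
have h2 : `|p i k u.1 - p i k t| < e / 4 by apply: hd' => //; lra.
have h3 : `|c i k * (u.2 - f t)| < e / 4.
  rewrite normrM; apply: lt_le_trans ne; apply: le_lt_trans u2.
  by rewrite ler_piMl // ltW.
have h4 : `|c i k * u.2 + p i k u.1 - f w| < e / 4 by apply: lt_le_trans ne.
have := mulrBr (c i k) u.2 (f t).
move: h1 h2 h3 h4; rewrite !ler_norml !ltr_norml; lra.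
Qed.

End Orbit.

(** * Derivatives of a super fractal interpolation function *)

Theorem theorem4p3 (R : realType) (N M n : nat) (x : nat -> R)
    (gamma : 'I_N -> 'I_M -> R) (q : 'I_N -> 'I_M -> R -> R)
    (gammaj : nat -> 'I_N -> 'I_M -> R) (qj : nat -> 'I_N -> 'I_M -> R -> R)
    (y : nat -> nat -> R) (sigma : nat -> 'I_M) (g : R -> R)
    (hN : (2 <= N)%N) (hM : (1 < M)%N)
    (hx : forall i, (i < N)%N -> x i < x i.+1)
    (hgamma : forall i k, `|gamma i k| < slope N x i ^+ n)
    (hq : forall i k, Cn_in (node_itv N x) n (q i k))
    (hgamma0 : forall i k, gammaj 0%N i k = gamma i k)
    (hq0 : forall i k t, node_itv N x t -> qj 0%N i k t = q i k t)
    (hgammaj : forall j, (1 <= j <= n)%N -> forall i k,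
      gammaj j i k = gamma i k / slope N x i ^+ j)
    (hqj : forall j, (1 <= j <= n)%N -> forall i k t, node_itv N x t ->
      qj j i k t = derive_in (node_itv N x) (qj j.-1 i k) t / slope N x i)
    (hdist : forall i k l, k != l -> gamma i k != gamma i l)
    (hjoin : forall j, (j <= n)%N -> join_up x (y j) (gammaj j) (qj j))
    (hint : forall j, (j <= n)%N -> forall k l, k != l ->
      integral_ratio x (gammaj j) (qj j) k = integral_ratio x (gammaj j) (qj j) l
      /\ integral_ratio x (gammaj j) (qj j) l != 1)
    (hg : is_SFIF x (y 0%N) (gammaj 0%N) (qj 0%N) sigma g) :
  forall j, (1 <= j <= n)%N ->
    derivable_in_n (node_itv N x) j g /\
    is_SFIF x (y j) (gammaj j) (qj j) sigma (derive_in_n (node_itv N x) j g).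
Proof.
set I := node_itv N x in hq hq0 hqj *; set a := slope N x.
have x0N : x 0%N < x N := nodes_lt hN hx.
have a0 (i : 'I_N) : 0 < a i := slope_gt0 hN hx (ltn_ord i).
have a1 (i : 'I_N) : a i < 1 := slope_lt1 hN hx (ltn_ord i).
have aN0 (i : 'I_N) : a i != 0 by rewrite gt_eqF.
have gammaE j i k : (j <= n)%N -> gammaj j i k = gamma i k / a i ^+ j.
  by case: j => [|j] jn; [rewrite hgamma0 expr0 divr1|rewrite hgammaj].
have gamma_lt j i k : (j <= n)%N -> `|gammaj j i k| < a i ^+ (n - j).
  by move=> jn; rewrite gammaE //; exact: scale_lt_slope.
have gamma_lt1 j i k : (j <= n)%N -> `|gammaj j i k| < 1.
  by move=> jn; apply: lt_le_trans (gamma_lt j i k jn) _; rewrite exprn_ile1 // ltW.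
have gammaS j i k : (j < n)%N -> gammaj j.+1 i k = gammaj j i k / a i.
  by move=> jn; rewrite !gammaE ?(ltnW jn) // div_exprS.
have qE j i k t : (j <= n)%N -> I t -> qj j i k t = derive_in_n I j (q i k) t / a i ^+ j.
  elim: j t => [|j IH] t jn It; first by rewrite expr0 divr1 hq0.
  rewrite hqj // -[j.+1.-1]/j div_exprS; congr (_ / _).
  apply: (derive_inE x0N It).
  have := has_deriv_scale (b := (a i ^+ j)^-1) It (Cn_in_has_deriv (hq i k) jn It).
  by apply: has_deriv_eq => // u Iu; rewrite IH // ltnW.
have q_deriv j i k t : (j < n)%N -> I t ->
    has_deriv I (qj j i k) t (qj j.+1 i k t * a i).
  move=> jn It; rewrite qE // div_exprS divfK //.
  have := has_deriv_scale (b := (a i ^+ j)^-1) It (Cn_in_has_deriv (hq i k) jn It).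
  by apply: has_deriv_eq => // u Iu; rewrite qE // ltnW.
have q_cont j i k : (j <= n)%N -> {within I, continuous (qj j i k)}.
  move=> jn; have := within_continuous_scale (b := (a i ^+ j)^-1)
    (Cn_in_continuous (hq i k) jn).
  by apply: within_continuous_eq => t It; rewrite qE.
have [[c1 _ q0c _] gc g_attr] := hg.
have [m0 rec_m0] := eventually_recurrent sigma.
have main j : (j <= n)%N -> [/\ derivable_in_n I j g,
    {within I, continuous (derive_in_n I j g)} &
    forall k, recurrent sigma k ->
      self_affine x (gammaj j ^~ k) (qj j ^~ k) (derive_in_n I j g)].
  elim: j => [|j IH] jn.
    by split=> // k; exact: (attractor_self_affine hN hx (fun i => c1 i k)
      (fun i => @q0c i k) gc g_attr).
  have [gd gjc ga] := IH (ltnW jn).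
  (* One recurrent symbol is enough for differentiability; the equations of the
     others follow by differentiation. *)
  have [||||d dc gjd] := self_affine_C1 hN hx (p' := fun i t => qj j.+1 i (sigma m0) t * a i)
    (z' := y j.+1) _ _ _ _ gjc (ga _ (rec_m0 _ (leqnn m0))).
  - by move=> i t It; exact: q_deriv.
  - move=> i; apply: lt_le_trans (gamma_lt j i _ (ltnW jn)) _.
    by rewrite ler_iXnr ?subn_gt0 // ltW.
  - by move=> i; apply: within_continuous_scale; exact: q_cont.
  - by move=> i; rewrite -gammaS // !mulfK //; exact: hjoin.
  have dE t : I t -> derive_in_n I j.+1 g t = d t.
    by move=> It; apply: (derive_inE x0N It); exact: gjd.
  have gjd' t : I t -> has_deriv I (derive_in_n I j g) t (derive_in_n I j.+1 g t).
    by move=> It; rewrite dE //; exact: gjd.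
  split.
  - move=> m; rewrite ltnS leq_eqVlt => /orP[/eqP-> t It|]; last exact: gd.
    by apply: has_deriv_derivable; exact: gjd'.
  - by apply: within_continuous_eq dc => t It; rewrite dE.
  - move=> k rk i t It.
    have := self_affine_deriv hN hx (p' := fun i t => qj j.+1 i k t * a i) _ gjd' (ga k rk).
    move=> /(_ _ i t It) ->; last by move=> i' u Iu; exact: q_deriv.
    by rewrite gammaS // mulfK.
move=> j /andP[_ jn]; have [gd gjc ga] := main j jn; split=> //.
split=> //; last first.
  apply: (@self_affine_attractor _ _ _ _ _ hN hx _ _ _ _ m0) => //.
    by move=> i k; exact: gamma_lt1.
  by move=> m mm; apply: ga; exact: rec_m0.
split.
- by move=> i k; exact: gamma_lt1.
- move=> i k l kl; rewrite !gammaE //; apply: contra (hdist i k l kl).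
  by move=> /eqP/(divIf (expf_neq0 _ (aN0 i))) ->.
- by move=> i k; exact: q_cont.
- exact: hjoin.
Qed.
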